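(* Let $q\in\mathbb{H}_{\mathbb R}$ with $\mathrm{Sc}(q)>1$. Then the quaternionic B-splines satisfy the recursion relation $$(q-1)B_q(t)=t\,B_{q-1}(t)+(q-t)\,B_{q-1}(t-1),\qquad t\in\mathbb{R}.$$
   Context: $\mathbb{H}_{\mathbb R}$ is the real quaternion algebra with basis $1,e_1,e_2,e_3$. Write $q=a+v$ with scalar part $a=\mathrm{Sc}(q)$ and vector part $v=\sum_{j=1}^3v_je_j$. For $t>0$, $t^q:=t^a[\cos(|v|\log t)+\frac{v}{|v|}\sin(|v|\log t)]$ (second term $0$ if $v=0$); $t_+^q:=t^q$ if $t>0$ and $t_+^q:=0$ otherwise. $\binom{q}{k}:=\frac{q(q-1)\cdots(q-k+1)}{k!}$ (equal to $1$ for $k=0$), and $\Gamma(q):=\int_0^\infty t^{q-1}e^{-t}\,dt$ for $\mathrm{Sc}(q)>0$. For $p\in\mathbb{H}_{\mathbb R}$ with $\mathrm{Sc}(p)>0$ the quaternionic B-spline $B_p$ is given by $$B_p(t)=\frac1{\Gamma(p)}\sum_{k=0}^\infty(-1)^k\binom pk(t-k)_+^{p-1},\qquad t\in\mathbb{R}$$ (for each $t$ only finitely many terms are nonzero). For $\mathrm{Sc}(p)>1$ this is the function with Fourier transform $\widehat{B_p}(\xi)=\left(\frac{1-e^{-i\xi}}{i\xi}\right)^p$. *)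

(* Defs.v *)
From HB Require Import structures.
From mathcomp Require Import all_boot all_order all_algebra.
From mathcomp Require Import ring lra.
From mathcomp Require Import all_classical all_reals all_analysis.

Set Implicit Arguments.
Unset Strict Implicit.
Unset Printing Implicit Defensive.
Import Order.TTheory GRing.Theory Num.Theory.
Import numFieldNormedType.Exports.
Local Open Scope classical_set_scope.
Local Open Scope ring_scope.

(* [Quat a x y z] is a + x e_1 + y e_2 + z e_3. *)
Record quaternion (R : Type) : Type :=
  Quat { Sc : R; vec1 : R; vec2 : R; vec3 : R }.

Definition quaternion_tuple (R : Type) (q : quaternion R) : R * R * R * R :=
  (Sc q, vec1 q, vec2 q, vec3 q).

Definition tuple_quaternion (R : Type) (u : R * R * R * R) : quaternion R :=
  let: (a, x, y, z) := u in Quat a x y z.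

Lemma quaternion_tupleK (R : Type) :
  cancel (@quaternion_tuple R) (@tuple_quaternion R).
Proof. by case. Qed.

HB.instance Definition _ (R : eqType) :=
  Equality.copy (quaternion R) (can_type (@quaternion_tupleK R)).
HB.instance Definition _ (R : choiceType) :=
  Choice.copy (quaternion R) (can_type (@quaternion_tupleK R)).

Section QuaternionAlgebra.
Variable R : realFieldType.
Implicit Types (p q r : quaternion R) (c : R).

Definition quat_zero : quaternion R := Quat 0 0 0 0.
Definition quat_one : quaternion R := Quat 1 0 0 0.
Definition quat_add p q :=
  Quat (Sc p + Sc q) (vec1 p + vec1 q) (vec2 p + vec2 q) (vec3 p + vec3 q).
Definition quat_opp q := Quat (- Sc q) (- vec1 q) (- vec2 q) (- vec3 q).
Definition quat_scale c q :=
  Quat (c * Sc q) (c * vec1 q) (c * vec2 q) (c * vec3 q).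

(* e_1^2 = e_2^2 = e_3^2 = e_1 e_2 e_3 = -1 *)
Definition quat_mul p q :=
  Quat
    (Sc p * Sc q - vec1 p * vec1 q - vec2 p * vec2 q - vec3 p * vec3 q)
    (Sc p * vec1 q + vec1 p * Sc q + vec2 p * vec3 q - vec3 p * vec2 q)
    (Sc p * vec2 q - vec1 p * vec3 q + vec2 p * Sc q + vec3 p * vec1 q)
    (Sc p * vec3 q + vec1 p * vec2 q - vec2 p * vec1 q + vec3 p * Sc q).

Definition quat_normsq q : R :=
  Sc q ^+ 2 + vec1 q ^+ 2 + vec2 q ^+ 2 + vec3 q ^+ 2.
Definition quat_conj q := Quat (Sc q) (- vec1 q) (- vec2 q) (- vec3 q).
Definition quat_inv q := quat_scale (quat_normsq q)^-1 (quat_conj q).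

Lemma quat_addA : associative quat_add.
Proof. by move=> [????] [????] [????]; rewrite /quat_add /= !addrA. Qed.
Lemma quat_addC : commutative quat_add.
Proof. by move=> [????] [????]; congr Quat; rewrite addrC. Qed.
Lemma quat_add0 : left_id quat_zero quat_add.
Proof. by move=> [????]; congr Quat; rewrite add0r. Qed.
Lemma quat_addN : left_inverse quat_zero quat_opp quat_add.
Proof. by move=> [????]; congr Quat; rewrite addNr. Qed.

HB.instance Definition _ :=
  GRing.isZmodule.Build (quaternion R) quat_addA quat_addC quat_add0 quat_addN.

Lemma quat_mulA : associative quat_mul.
Proof. by move=> [????] [????] [????]; congr Quat => /=; ring. Qed.
Lemma quat_1mul : left_id quat_one quat_mul.
Proof. by move=> [????]; congr Quat => /=; ring. Qed.
Lemma quat_mul1 : right_id quat_one quat_mul.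
Proof. by move=> [????]; congr Quat => /=; ring. Qed.
Lemma quat_mulDl : left_distributive quat_mul +%R.
Proof. by move=> [????] [????] [????]; congr Quat => /=; ring. Qed.
Lemma quat_mulDr : right_distributive quat_mul +%R.
Proof. by move=> [????] [????] [????]; congr Quat => /=; ring. Qed.
Lemma quat_one_neq0 : quat_one != 0.
Proof. by apply/eqP => -[] /eqP; rewrite oner_eq0. Qed.

HB.instance Definition _ := GRing.Zmodule_isNzRing.Build (quaternion R)
  quat_mulA quat_1mul quat_mul1 quat_mulDl quat_mulDr quat_one_neq0.

Lemma quat_scaleA c d q : quat_scale c (quat_scale d q) = quat_scale (c * d) q.
Proof. by congr Quat; rewrite /= mulrA. Qed.
Lemma quat_scale1 : left_id 1 quat_scale.
Proof. by case=> *; congr Quat; rewrite mul1r. Qed.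
Lemma quat_scaleDr : right_distributive quat_scale +%R.
Proof. by move=> c [????] [????]; congr Quat => /=; ring. Qed.
Lemma quat_scaleDl q : {morph quat_scale^~ q : c d / c + d}.
Proof. by move=> c d; congr Quat => /=; ring. Qed.

HB.instance Definition _ := GRing.Zmodule_isLmodule.Build R (quaternion R)
  quat_scaleA quat_scale1 quat_scaleDr quat_scaleDl.

Lemma quat_scaleAl c p q : c *: (p * q) = c *: p * q.
Proof. by congr Quat => /=; ring. Qed.

HB.instance Definition _ :=
  GRing.Lmodule_isLalgebra.Build R (quaternion R) quat_scaleAl.

Lemma quat_scaleAr c p q : c *: (p * q) = p * (c *: q).
Proof. by congr Quat => /=; ring. Qed.

HB.instance Definition _ :=
  GRing.Lalgebra_isAlgebra.Build R (quaternion R) quat_scaleAr.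

Lemma quat_normsq_eq0 q : (quat_normsq q == 0) = (q == 0).
Proof.
case: q => a x y z; apply/eqP/eqP; last first.
  by move=> ->; rewrite /quat_normsq /=; ring.
have := (sqr_ge0 a, sqr_ge0 x, sqr_ge0 y, sqr_ge0 z) => -[[[a0 x0] y0] z0].
rewrite /quat_normsq /= => s0.
have sq0 u : u ^+ 2 <= 0 -> 0 <= u ^+ 2 -> u = 0 :> R.
  by move=> ? ?; apply/eqP; rewrite -sqrf_eq0 eq_le; apply/andP.
rewrite -[RHS]/(Quat 0 0 0 0).
by congr Quat; apply: sq0 => //; lra.
Qed.

Lemma quat_mulVl : {in [pred q | q != 0], left_inverse 1 quat_inv *%R}.
Proof.
move=> q; rewrite inE -quat_normsq_eq0 /quat_normsq => q0.
by congr Quat => /=; rewrite /quat_normsq; field.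
Qed.
Lemma quat_mulV : {in [pred q | q != 0], right_inverse 1 quat_inv *%R}.
Proof.
move=> q; rewrite inE -quat_normsq_eq0 /quat_normsq => q0.
by congr Quat => /=; rewrite /quat_normsq; field.
Qed.
Lemma quat_unitP p q : q * p = 1 /\ p * q = 1 -> p != 0.
Proof.
case=> qp _; apply/eqP => p0; move: qp; rewrite p0 mulr0 => /esym/eqP.
by rewrite oner_eq0.
Qed.
Lemma quat_inv_out : {in [predC [pred q | q != 0]], quat_inv =1 id}.
Proof.
move=> q; rewrite !inE negbK => /eqP ->.
by congr Quat => /=; rewrite ?oppr0 mulr0.
Qed.

HB.instance Definition _ := GRing.NzRing_hasMulInverse.Build (quaternion R)
  quat_mulVl quat_mulV quat_unitP quat_inv_out.

End QuaternionAlgebra.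

Section QuaternionicBSpline.
Variable R : realType.
Implicit Types (p q : quaternion R) (t : R) (k : nat).

Definition vecq q : quaternion R := Quat 0 (vec1 q) (vec2 q) (vec3 q).
Definition quat_norm q : R := Num.sqrt (quat_normsq q).

(* Used for t > 0 only. If v = 0, the second summand is a multiple of the zero
   quaternion v, hence 0. *)
Definition qpow t q : quaternion R :=
  let v := vecq q in
  t `^ Sc q *: ((cos (quat_norm v * ln t))%:A
                + sin (quat_norm v * ln t) *: ((quat_norm v)^-1 *: v)).

Definition qpow_plus t q : quaternion R := if 0 < t then qpow t q else 0.

Definition qbinom q k : quaternion R :=
  (k`!%:R)^-1 *: \prod_(i < k) (q - i%:R).

(* Limits and integrals of quaternion-valued functions are componentwise. *)
Definition qlim (u : nat -> quaternion R) : quaternion R :=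
  Quat (limn (fun n => Sc (u n))) (limn (fun n => vec1 (u n)))
       (limn (fun n => vec2 (u n))) (limn (fun n => vec3 (u n))).

Definition qintegral (D : set R) (f : R -> quaternion R) : quaternion R :=
  let mu := @lebesgue_measure R in
  Quat (\int[mu]_(t in D) Sc (f t)) (\int[mu]_(t in D) vec1 (f t))
       (\int[mu]_(t in D) vec2 (f t)) (\int[mu]_(t in D) vec3 (f t)).

(* Meaningful for Sc q > 0, where the integrand is absolutely integrable. *)
Definition qGamma q : quaternion R :=
  qintegral `]0, +oo[ (fun t => expR (- t) *: qpow t (q - 1)).

Definition qBspline p t : quaternion R :=
  (qGamma p)^-1 *
  qlim (fun n => \sum_(0 <= k < n)
                   (-1) ^+ k * qbinom p k * qpow_plus (t - k%:R) (p - 1)).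

End QuaternionicBSpline.

(* Main.v *)
(* With s = q - 1 and (t-k)_+^s = (t-k) (t-k)_+^(s-1), the coefficients of
   (t-k)_+^(s-1) on both sides agree by Pascal's rule and k C(q,k) = q C(s,k-1),
   provided Gamma(q) = s Gamma(s). The latter is integration by parts: the
   coordinates of e^-t t^s are combinations of e^-t t^a cos(|v| ln t) and
   e^-t t^a sin(|v| ln t), where a = Sc s > 0, whose boundary terms vanish at 0
   and at infinity. *)
Require Import Defs.
From mathcomp Require Import all_boot all_order all_algebra.
From mathcomp Require Import ring lra.
From mathcomp Require Import all_classical all_reals all_analysis.
From mathcomp Require Import measurable_realfun.
Import Order.TTheory GRing.Theory Num.Theory.
Import numFieldNormedType.Exports.
Local Open Scope classical_set_scope.
Local Open Scope ring_scope.

(** * Quaternionic binomial identities and the reduction to a Gamma identity *)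

Section BsplineAlgebra.
Context {R : realType}.
Implicit Types (q s : quaternion R) (t : R) (k n : nat).

Lemma qlim_near_cst (u : nat -> quaternion R) l N :
  (forall n, (N <= n)%N -> u n = l) -> qlim u = l.
Proof.
move=> uN; case: l uN => a x y z uN; rewrite /qlim.
have E T (g : quaternion R -> R) : g (Quat a x y z) = T ->
    limn (fun n => g (u n)) = T.
  by move=> <-; apply: lim_near_cst => //; exists N => // n /uN ->.
by rewrite !(E _ _ erefl).
Qed.

Lemma qbinom0 q : qbinom q 0 = 1.
Proof. by rewrite /qbinom big_ord0 fact0 invr1 scale1r. Qed.

Lemma qbinomSr q k : k.+1%:R *: qbinom q k.+1 = qbinom q k * (q - k%:R).
Proof.
rewrite /qbinom big_ord_recr /= scalerA -scalerAl; congr (_ *: _).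
by rewrite factS natrM invfM mulrA mulfV ?mul1r// pnatr_eq0.
Qed.

Lemma qbinomSl q k : k.+1%:R *: qbinom q k.+1 = q * qbinom (q - 1) k.
Proof.
rewrite /qbinom big_ord_recl /= scalerA subr0 -scalerAr; congr (_ *: (_ * _)).
  by rewrite factS natrM invfM mulrA mulfV ?mul1r// pnatr_eq0.
by apply: eq_bigr => i _; rewrite /bump/= add1n -addrA -opprD -mulrS.
Qed.

Lemma comm_qbinom q s k : GRing.comm q s -> GRing.comm q (qbinom s k).
Proof.
move=> qs; rewrite /qbinom /GRing.comm -scalerAr -scalerAl; congr (_ *: _).
apply: commr_prod => i _; apply: commrB => //; exact: commr_nat.
Qed.

Lemma comm_subr1 q : GRing.comm q (q - 1).
Proof. by apply: commrB; [exact: commr_refl|exact: commr1]. Qed.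

(** Multiplied by [k.+1], both sides become [q * qbinom (q - 1) k]; on the right the factor [q]
    arises on the other side and is moved by commutation. *)
Lemma qbinom_pascal q k :
  qbinom q k.+1 = qbinom (q - 1) k.+1 + qbinom (q - 1) k.
Proof.
apply: (@scalerI _ _ k.+1%:R); first by rewrite pnatr_eq0.
rewrite scalerDr qbinomSl qbinomSr scaler_nat -(mulr_natr _ k.+1) -mulrDr.
by rewrite -natr1 addrA !subrK (comm_qbinom q _ k (comm_subr1 q)).
Qed.

(** The coefficient identity behind the recursion: Pascal's rule handles the [t] part, absorption
    ([qbinomSl]) the [k.+1] part. *)
Lemma qbinom_Bspline q k t :
  (t - k.+1%:R) *: qbinom q k.+1 =
  t *: qbinom (q - 1) k.+1 - (q - t%:A) * qbinom (q - 1) k.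
Proof.
rewrite scalerBl qbinomSl qbinom_pascal scalerDr mulrBl -scalerAl mul1r.
by rewrite opprB addrA.
Qed.

Lemma vecq_subr1 q : vecq (q - 1) = vecq q.
Proof. by rewrite /vecq /= !subr0. Qed.

Lemma qpow_plusMl q t : 1 < Sc q ->
  qpow_plus t (q - 1) = t *: qpow_plus t (q - 1 - 1).
Proof.
move=> q1; rewrite /qpow_plus; case: ifPn => [t0|]; last by rewrite scaler0.
by rewrite /qpow !vecq_subr1 [RHS]scalerA /= mulr_powRB1 ?(ltW t0) ?subr_gt0//.
Qed.

Definition qterm q s t k : quaternion R :=
  (-1) ^+ k * qbinom q k * qpow_plus (t - k%:R) s.

(** The term at [0] is matched by the first sum on the right alone. Term [k.+1] is matched by term
    [k.+1] of that sum and term [k] of the shifted one, hence the shorter second sum. *)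
Lemma sum_qterm q t N : 1 < Sc q ->
  \sum_(0 <= k < N.+1) qterm q (q - 1) t k =
  t *: \sum_(0 <= k < N.+1) qterm (q - 1) (q - 1 - 1) t k +
  (q - t%:A) * \sum_(0 <= k < N) qterm (q - 1) (q - 1 - 1) (t - 1) k.
Proof.
move=> q1; rewrite big_nat_recl// [X in _ *: X]big_nat_recl// scalerDr.
rewrite scaler_sumr mulr_sumr -addrA -big_split/=.
congr (_ + _).
  by rewrite /qterm !qbinom0 subr0 mulr1 mul1r qpow_plusMl// mul1r.
apply: eq_bigr => k _; rewrite /qterm qpow_plusMl//.
have -> : t - 1 - k%:R = t - k.+1%:R by rewrite -addrA -opprD -mulrS.
set x := qpow_plus _ _; rewrite -scalerAr scalerAl scalerAr.
rewrite qbinom_Bspline mulrBr mulrBl -scalerAr -scalerAl; congr (_ + _).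
rewrite exprS mulN1r !mulNr opprK !mulrA.
by have -> : (q - t%:A) * (-1) ^+ k = (-1) ^+ k * (q - t%:A)
  by exact/commr_sign.
Qed.

(** Terms with [k >= N] vanish because [t - k <= 0], so the partial sums are stationary from [N]
    on. *)
Lemma qlim_qterm q s t N : t <= N%:R ->
  qlim (fun n => \sum_(0 <= k < n) qterm q s t k) =
  \sum_(0 <= k < N) qterm q s t k.
Proof.
move=> tN; apply: (@qlim_near_cst _ _ N) => n Nn.
rewrite (big_cat_nat (leq0n N) Nn)/= [X in _ + X]big1_seq ?addr0// => k.
rewrite mem_index_iota => /andP[_ /andP[Nk _]].
rewrite /qterm /qpow_plus subr_gt0 ltNge (le_trans tN) ?ler_nat//.
by rewrite mulr0.
Qed.

(** Isolates what is needed from Gamma: the functional equation absorbs the factor [q - 1], and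
    commutation lets the inverse of [qGamma (q - 1)] pass [q - t%:A]. *)
Lemma Bspline_recursion_of_Gamma q t : 1 < Sc q ->
  qGamma q = qGamma (q - 1) * (q - 1) -> GRing.comm q (qGamma (q - 1)) ->
  (q - 1) * qBspline q t =
    t *: qBspline (q - 1) t + (q - t%:A) * qBspline (q - 1) (t - 1).
Proof.
move=> q1 qG qC; set s := q - 1.
have [N tN] : exists N : nat, t <= N%:R.
  exists (Num.bound `|t|).
  by rewrite (le_trans (ler_norm t))// ltW// archi_boundP.
(* Truncation at [N.+1] for [t] and at [N] for [t - 1] gives exactly the lengths in [sum_qterm]. *)
have tN1 : t <= N.+1%:R by rewrite (le_trans tN)// ler_nat.
rewrite /qBspline.
rewrite (qlim_qterm q (q - 1) t N.+1)//.
rewrite (qlim_qterm s (s - 1) t N.+1)//.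
rewrite (qlim_qterm s (s - 1) (t - 1) N)//; last by rewrite lerBlDr natr1.
have -> : (q - 1) * ((qGamma q)^-1 *
   \sum_(0 <= k < N.+1) qterm q (q - 1) t k) = (qGamma s)^-1 *
   \sum_(0 <= k < N.+1) qterm q (q - 1) t k.
  rewrite mulrA; congr (_ * _); rewrite qG -/s.
  (* If [qGamma s] vanished, then so would [qGamma q], and both inverses would
     be [0^-1 = 0]; hence non-vanishing of Gamma is not an issue. *)
  have [->|G0] := eqVneq (qGamma s) 0; first by rewrite mul0r !invr0 mulr0.
  have s0 : s != 0.
    apply/eqP => /(congr1 (@Sc R)) /= /eqP.
    by rewrite subr_eq0 gt_eqF.
  by rewrite invrM// mulVKr.
rewrite sum_qterm// mulrDr -scalerAr; congr (_ + _).
rewrite !mulrA; congr (_ * _); symmetry.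
apply: commrV; apply/commr_sym; apply: commrB; first exact/commr_sym.
by rewrite /GRing.comm -scalerAl -scalerAr mulr1 mul1r.
Qed.

End BsplineAlgebra.

(** * The fundamental theorem of calculus on the open half-line *)

Section HalfLineFTC.
Context {R : realType}.
Implicit Types f g F G : R -> R.
Local Notation mu := (@lebesgue_measure R).

(** The index starts at [2] so that every interval has distinct endpoints, as the fundamental
    theorem on it requires. *)
Lemma itv0y_bigcup :
  `]0, +oo[%classic = \bigcup_n `[n.+2%:R^-1, n.+2%:R]%classic :> set R.
Proof.
apply/seteqP; split => x /=; rewrite in_itv/= ?andbT.
  (* Bounding both [x] and [x^-1] by [n] controls the two endpoints at once. *)
  move=> x0; pose n := Num.bound (Num.max x x^-1).
  have /ltW nb : Num.max x x^-1 < n%:R.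
    by apply: le_lt_trans (archi_boundP _); rewrite // le_max ltW.
  move: nb; rewrite ge_max => /andP[xn xVn].
  have n2 : n%:R <= n.+2%:R :> R by rewrite ler_nat ltnW.
  exists n => //=; rewrite in_itv/= (le_trans xn n2) andbT.
  by rewrite -[leRHS]invrK lef_pV2 ?posrE ?invr_gt0// (le_trans xVn).
move=> [n _] /=; rewrite in_itv/= => /andP[+ _].
by apply: lt_le_trans; rewrite invr_gt0.
Qed.

Lemma measurable_continuous_itv0y f :
  (forall x : R, 0 < x -> {for x, continuous f}) ->
  measurable_fun (`]0%R, +oo[%classic : set R) f.
Proof.
move=> cf; apply: open_continuous_measurable_fun => // x.
by rewrite inE/= in_itv/= andbT => /cf.
Qed.

(** Monotone convergence along the compact exhaustion; on each interval the integral is a difference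
    of values of [F], which tends to [ly - l0]. *)
Lemma ge0_continuous_FTC_itv0y f F (l0 ly : R) :
  (forall x : R, 0 < x -> is_derive x 1 F (f x)) ->
  (forall x : R, 0 < x -> {for x, continuous f}) ->
  (forall x : R, 0 < x -> 0 <= f x) ->
  F x @[x --> (0 : R)^'+] --> l0 -> F x @[x --> +oo%R] --> ly ->
  (\int[mu]_(x in `]0%R, +oo[) (f x)%:E = (ly - l0)%:E)%E.
Proof.
move=> dF cf f0 F0 Fy; rewrite itv0y_bigcup.
pose I (n : nat) : set R := `[n.+2%:R^-1, n.+2%:R]%classic.
have I0 n x : I n x -> 0 < x.
  by rewrite /I/= in_itv/= => /andP[+ _]; apply: lt_le_trans; rewrite invr_gt0.
have ndI : nondecreasing_seq I.
  move=> m n mn; rewrite subsetEset => x.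
  rewrite /I/= !in_itv/= => /andP[mx xm].
  apply/andP; split; last by rewrite (le_trans xm)// ler_nat.
  by apply: le_trans mx; rewrite lef_pV2 ?posrE// ler_nat.
have mI n : measurable (I n) by exact: measurable_itv.
have mf n : measurable_fun (I n) (EFin \o f).
  apply/measurable_EFinP.
  apply: measurable_funS (measurable_continuous_itv0y f cf) => //.
  by move=> x /I0; rewrite /= in_itv/= andbT.
have fI n x : I n x -> (0 <= (EFin \o f) x)%E by move=> /I0/f0; rewrite lee_fin.
have cI : (\int[mu]_(x in I n) (f x)%:E)%E @[n --> \oo] -->
    (\int[mu]_(x in \bigcup_n I n) (f x)%:E)%E.
  exact: ge0_nondecreasing_set_cvg_integral.
have <- := cvg_lim (@ereal_hausdorff R) cI; apply/cvg_lim => //=.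
have E n : (\int[mu]_(x in I n) (f x)%:E = (F n.+2%:R - F n.+2%:R^-1)%:E)%E.
  have n0 : 0 < n.+2%:R^-1 :> R by rewrite invr_gt0.
  have dFI x : n.+2%:R^-1 <= x -> derivable F x 1.
    by move=> nx; have [] := dF _ (lt_le_trans n0 nx).
  have dcF x : n.+2%:R^-1 <= x -> {for x, continuous F}.
    by move=> /dFI/derivable1_diffP/differentiable_continuous.
  rewrite EFinB; apply: continuous_FTC2.
  - by rewrite (@lt_trans _ _ 1)// ?ltr1n// invf_lt1// ltr1n.
  - apply: continuous_in_subspaceT => x; rewrite inE/= in_itv/= => /andP[nx _].
    exact/cf/(lt_le_trans n0).
  - split.
    + by move=> x; rewrite in_itv/= => /andP[/ltW/dFI].
    + exact/cvg_at_right_filter/dcF.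
    + apply/cvg_at_left_filter/dcF.
      by rewrite (@le_trans _ _ 1)// ?ler1n// invf_le1// ler1n.
  - move=> x; rewrite in_itv/= => /andP[nx _]; rewrite derive1E.
    by have [_ ->] := dF _ (lt_trans n0 nx).
under eq_fun do rewrite E.
apply: cvg_EFin; first by apply: nearW.
apply: cvgB.
- move/cvg_pinftyP : Fy; apply; apply/cvgryPge => M.
  near=> n; apply: (@le_trans _ _ n%:R); last by rewrite ler_nat ltnW.
  by near: n; exact: nbhs_infty_ger.
- move/cvg_at_rightP : F0; apply; split => [n|]; first by rewrite invr_gt0.
  apply/gtr0_cvgV0; first by apply: nearW => n; rewrite ltr0n.
  apply/cvgryPge => M.
  near=> n; apply: (@le_trans _ _ n%:R); last by rewrite ler_nat ltnW.
  by near: n; exact: nbhs_infty_ger.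
Unshelve. all: by end_near. Qed.

Lemma ge0_integrable_itv0y f F (l0 ly : R) :
  (forall x : R, 0 < x -> is_derive x 1 F (f x)) ->
  (forall x : R, 0 < x -> {for x, continuous f}) ->
  (forall x : R, 0 < x -> 0 <= f x) ->
  F x @[x --> (0 : R)^'+] --> l0 -> F x @[x --> +oo%R] --> ly ->
  mu.-integrable `]0, +oo[ (EFin \o f).
Proof.
move=> dF cf f0 F0 Fy; apply/integrableP; split.
  by apply/measurable_EFinP; exact: measurable_continuous_itv0y.
rewrite (@eq_integral _ _ _ mu _ (EFin \o f)).
  by rewrite (ge0_continuous_FTC_itv0y f F l0 ly)// ltry.
by move=> x; rewrite inE/= in_itv/= andbT => /f0 fx; rewrite ger0_norm.
Qed.

(** A signed [f] reduces to the nonnegative case: [f + g] and [g] are both nonnegative, and the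
    integral of [g] is subtracted. *)
Lemma Rintegral_continuous_FTC_itv0y f F g G (l0 ly m0 my : R) :
  (forall x : R, 0 < x -> is_derive x 1 F (f x)) ->
  (forall x : R, 0 < x -> {for x, continuous f}) ->
  F x @[x --> (0 : R)^'+] --> l0 -> F x @[x --> +oo%R] --> ly ->
  (forall x : R, 0 < x -> is_derive x 1 G (g x)) ->
  (forall x : R, 0 < x -> {for x, continuous g}) ->
  G x @[x --> (0 : R)^'+] --> m0 -> G x @[x --> +oo%R] --> my ->
  (forall x : R, 0 < x -> `|f x| <= g x) ->
  \int[mu]_(x in `]0%R, +oo[) f x = ly - l0.
Proof.
move=> dF cf F0 Fy dG cg G0 Gy fg.
have g0 x : 0 < x -> 0 <= g x by move=> /fg; apply: le_trans.
have ig := ge0_integrable_itv0y g G m0 my dG cg g0 G0 Gy.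
have Ig := ge0_continuous_FTC_itv0y g G m0 my dG cg g0 G0 Gy.
have mf := measurable_continuous_itv0y f cf.
have intf : mu.-integrable `]0, +oo[ (EFin \o f).
  apply: le_integrable ig => //; first exact/measurable_EFinP.
  move=> x; rewrite /= in_itv/= andbT lee_fin => /fg fgx.
  by rewrite (le_trans fgx)// ler_norm.
have := @ge0_continuous_FTC_itv0y (f \+ g) (F \+ G) (l0 + m0) (ly + my).
move=> /(_ _ _ _ _ _) H.
have {H} : (\int[mu]_(x in `]0%R, +oo[) ((f \+ g) x)%:E
    = (ly + my - (l0 + m0))%:E)%E.
  apply: H.
  - by move=> x x0; apply: is_deriveD; [exact: dF|exact: dG].
  - by move=> x x0; apply: continuousD; [exact: cf|exact: cg].
  - move=> x /fg; rewrite ler_norml /= => /andP[+ _].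
    by rewrite lerNl -subr_ge0 opprK addrC.
  - exact: cvgD.
  - exact: cvgD.
move=> /(congr1 fine) /= H.
apply: (addIr (my - m0)); transitivity (ly + my - (l0 + m0)); last by ring.
rewrite -H -[my - m0]/(fine (my - m0)%:E) -Ig.
by rewrite -[LHS]RintegralD.
Qed.

End HalfLineFTC.

(** * Derivatives, bounds and integration by parts for the Gamma integrands *)

Section GammaKernel.
Context {R : realType}.
Implicit Types (a b c d t : R).
Local Notation mu := (@lebesgue_measure R).

Definition expNpow a t : R := expR (- t) * t `^ a.

(* Coordinates of [expR (- t) * t ^ (a + v)] for [b = |v|]; [c] and [d] weigh
   the cosine and the sine part. *)
Definition gamma_kernel b a c d t : R :=
  expNpow a t * (c * cos (b * ln t) + d * sin (b * ln t)).

Lemma expNpow_ge0 a t : 0 <= expNpow a t.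
Proof. by rewrite mulr_ge0 ?expR_ge0 ?powR_ge0. Qed.

Lemma is_derive_expNpow a t : 0 < t ->
  is_derive t 1 (expNpow a) (a * expNpow (a - 1) t - expNpow a t).
Proof.
move=> t0; have dp : is_derive t 1 (fun x : R => x `^ a) (a * t `^ (a - 1)).
  exact: is_derive1_powR.
have dN : is_derive t 1 (expR \o -%R : R -> R) (expR (- t) * -1).
  exact: is_derive1_comp.
have dM := @is_deriveM _ _ _ _ _ _ _ _ dN dp.
apply: (@is_derive_eq _ _ _ _ _ _ _ _ dM).
rewrite /expNpow /= /GRing.scale/=; ring.
Qed.

(** With the trigonometric factor read as the real part of [(c - i d) exp (i b ln t)],
    differentiating it together with the power multiplies [c - i d] by [a + i b]. The subtracted
    kernel comes from [expR (- t)]. *)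
Lemma is_derive_gamma_kernel b a c d t : 0 < a -> 0 < t ->
  is_derive t 1 (gamma_kernel b a c d)
    (gamma_kernel b (a - 1) (a * c + b * d) (a * d - b * c) t -
     gamma_kernel b a c d t).
Proof.
move=> a0 t0; have de := is_derive_expNpow a t t0.
have dl : is_derive t 1 (b \*: @ln R) (b * t^-1).
  by apply: is_deriveZ; exact: is_derive1_ln.
have dc : is_derive t 1 (c \*: (cos \o (b \*: @ln R)))
    (c *: (- sin (b * ln t) * (b * t^-1))).
  by apply: is_deriveZ; exact: is_derive1_comp.
have ds : is_derive t 1 (d \*: (sin \o (b \*: @ln R)))
    (d *: (cos (b * ln t) * (b * t^-1))).
  by apply: is_deriveZ; exact: is_derive1_comp.
have dM := @is_deriveM _ _ _ _ _ _ _ _ de (@is_deriveD _ _ _ _ _ _ _ _ _ dc ds).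
apply: (@is_derive_eq _ _ _ _ _ _ _ _ dM).
rewrite /gamma_kernel /= /GRing.scale/=.
(* The extracted [t] cancels the [t^-1] produced by the logarithm. *)
have -> : expNpow a t = t * expNpow (a - 1) t.
  by rewrite /expNpow mulrCA mulr_powRB1// ltW.
rewrite -[X in X * (_ - _)]/(c * cos (b * ln t) + d * sin (b * ln t)).
by field; rewrite gt_eqF.
Qed.

Lemma continuous_expNpow a t : 0 < t -> {for t, continuous (expNpow a)}.
Proof.
move=> /(is_derive_expNpow a)[/derivable1_diffP + _].
exact: differentiable_continuous.
Qed.

Lemma continuous_gamma_kernel b a c d t :
  0 < t -> {for t, continuous (gamma_kernel b a c d)}.
Proof.
move=> t0; have cl : {for t, continuous (b \*: @ln R)}.
  by apply: continuousZr; exact: continuous_ln.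
apply: continuousM; first exact: continuous_expNpow.
by apply: continuousD; apply: continuousM; try exact: cst_continuous;
  apply: continuous_comp => //; [exact: continuous_cos|exact: continuous_sin].
Qed.

Lemma norm_gamma_kernel_le b a c d t :
  `|gamma_kernel b a c d t| <= (`|c| + `|d|) * expNpow a t.
Proof.
rewrite /gamma_kernel normrM (ger0_norm (expNpow_ge0 _ _)) mulrC.
rewrite ler_wpM2r ?expNpow_ge0// (le_trans (ler_normD _ _))// !normrM.
by rewrite lerD// ler_piMr// ler_norml ?cos_geN1 ?cos_le1 ?sin_geN1 ?sin_le1.
Qed.

(* The maximum over [t > 0] of [expR (t / 2) * expNpow a t], attained at
   [2 * a]. *)
Definition expNpow_cst a : R := expR (a * ln (2 * a) - a).

(** In logarithmic form this is [ln x <= x - 1] at [x = t / (2 * a)], multiplied by [a]. *)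
Lemma expNpow_le a t : 0 < a -> 0 < t ->
  expNpow a t <= expNpow_cst a * expR (- (t / 2)).
Proof.
move=> a0 t0; rewrite /expNpow /powR gt_eqF// -!expRD ler_expR.
have := @le_ln1Dx R (t / (2 * a) - 1).
have ta : 0 < t / (2 * a) by rewrite divr_gt0// mulr_gt0.
rewrite subrKC ltrBrDl subrr => /(_ ta).
rewrite ln_div ?posrE ?mulr_gt0// => /(ler_wpM2l (ltW a0)).
have -> : a * (t / (2 * a) - 1) = t / 2 - a by field; rewrite gt_eqF.
lra.
Qed.

Lemma cvgy_expR_half : expR (- (t / 2)) @[t --> +oo%R] --> (0 : R).
Proof.
apply: (@cvg_comp _ _ _ (fun t : R => t / 2) (fun t => expR (- t)) _ +oo%R).
  by apply: gt0_cvgMly => //; exact: cvg_id.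
exact: cvgr_expR.
Qed.

Lemma cvgy_expNpow a : 0 < a -> expNpow a t @[t --> +oo%R] --> (0 : R).
Proof.
move=> a0.
apply: (@squeeze_cvgr _ _ _ _ (cst 0)
  (fun t => expNpow_cst a * expR (- (t / 2)))).
- near=> t; rewrite expNpow_ge0 expNpow_le//.
- exact: cvg_cst.
- by rewrite -[X in _ --> X](mulr0 (expNpow_cst a)); apply: cvgMr;
  exact: cvgy_expR_half.
Unshelve. all: by end_near. Qed.

Lemma cvg0_expNpow a : 0 < a -> expNpow a t @[t --> (0 : R)^'+] --> (0 : R).
Proof.
move=> a0; rewrite -[X in _ --> X](mulr0 (expR (- 0))).
apply: cvgM; last exact: powR_cvg0.
apply: cvg_at_right_filter; apply: continuous_comp.
  exact: opp_continuous.
exact: continuous_expR.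
Qed.

Lemma cvg_gamma_kernel F b a c d : Filter F ->
  expNpow a t @[t --> F] --> (0 : R) ->
  gamma_kernel b a c d t @[t --> F] --> (0 : R).
Proof.
move=> FF e0; apply/norm_cvg0P.
apply: (@squeeze_cvgr _ _ _ _ (cst 0) (fun t => (`|c| + `|d|) * expNpow a t)).
- by near=> t; rewrite normr_ge0 norm_gamma_kernel_le.
- exact: cvg_cst.
- by rewrite -[X in _ --> X](mulr0 (`|c| + `|d|)); apply: cvgMr.
Unshelve. all: by end_near. Qed.

(* A bounded primitive of a function dominating
   [K * (expNpow (a - 1) + expNpow a)], which yields integrability near both
   endpoints at once. *)
Definition expNpow_dom a K t : R :=
  K / a * expNpow a t - 2 * (K * (1 + a^-1) * expNpow_cst a) * expR (- (t / 2)).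

Definition expNpow_dom' a K t : R :=
  K / a * (a * expNpow (a - 1) t - expNpow a t) +
  K * (1 + a^-1) * expNpow_cst a * expR (- (t / 2)).

Lemma is_derive_expNpow_dom a K t : 0 < t ->
  is_derive t 1 (expNpow_dom a K) (expNpow_dom' a K t).
Proof.
move=> t0; have de := is_derive_expNpow a t t0.
have dh : is_derive t 1 (expR \o (- 2^-1) \*: id : R -> R)
   (expR (- 2^-1 * t) * (- 2^-1 *: 1)).
  exact: is_derive1_comp.
set L := K * (1 + a^-1) * expNpow_cst a.
have dZ := @is_deriveZ _ _ _ _ (2 * L) _ _ _ dh.
have dY := @is_deriveZ _ _ _ _ (K / a) _ _ _ de.
have dM := @is_deriveB _ _ _ _ _ _ _ _ _ dY dZ.
have -> : expNpow_dom a K = (K / a) \*: expNpow a -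
   (2 * L) \*: (expR \o (- 2^-1) \*: id : R -> R).
  apply/funext => x; rewrite /expNpow_dom -/L.
  by have -> : - (x / 2) = - 2^-1 * x by ring.
apply: (@is_derive_eq _ _ _ _ _ _ _ _ dM).
rewrite /expNpow_dom' /GRing.scale/= -/L.
have -> : - (t / 2) = - 2^-1 * t by ring.
by congr (_ + _); field.
Qed.

(** Adding [K * (1 + a^-1) * expNpow a t] to the first summand of [expNpow_dom'] gives exactly the
    left side; [expNpow_le] bounds the added term by the exponential summand. *)
Lemma expNpow_dom'_ge a K t : 0 < a -> 0 <= K -> 0 < t ->
  K * (expNpow (a - 1) t + expNpow a t) <= expNpow_dom' a K t.
Proof.
move=> a0 K0 t0.
have K1 : 0 <= K * (1 + a^-1) by rewrite mulr_ge0// addr_ge0// invr_ge0 ltW.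
rewrite /expNpow_dom' -(mulrA _ (expNpow_cst a)).
apply: (le_trans _ (lerD (lexx _) (ler_wpM2l K1 (expNpow_le a t a0 t0)))).
rewrite le_eqVlt; apply/orP; left; apply/eqP; field.
by rewrite gt_eqF.
Qed.

Lemma continuous_expNpow_dom' a K t : 0 < t ->
  {for t, continuous (expNpow_dom' a K)}.
Proof.
move=> t0; apply: continuousD; apply: continuousM; try exact: cst_continuous.
  apply: continuousB; last exact: continuous_expNpow.
  by apply: continuousM; [exact: cst_continuous|exact: continuous_expNpow].
apply: continuous_comp; last exact: continuous_expR.
by apply: continuousN; apply: continuousM => //; exact: cst_continuous.
Qed.

Lemma cvg0_expNpow_dom a K : 0 < a ->
  expNpow_dom a K t @[t --> (0 : R)^'+] --> expNpow_dom a K 0.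
Proof.
move=> a0; apply: cvgB.
  rewrite /expNpow powR0 ?gt_eqF// !mulr0 -[X in _ --> X](mulr0 (K / a)).
  by apply: cvgMr; exact: cvg0_expNpow.
apply: cvgMr; apply: cvg_at_right_filter.
apply: continuous_comp; last exact: continuous_expR.
by apply: continuousN; apply: continuousM => //; exact: cst_continuous.
Qed.

Lemma cvgy_expNpow_dom a K : 0 < a ->
  expNpow_dom a K t @[t --> +oo%R] --> (0 : R).
Proof.
move=> a0; rewrite -(subr0 0) -{1}(mulr0 (K / a)).
rewrite -[X in _ - X](mulr0 (2 * (K * (1 + a^-1) * expNpow_cst a))).
apply: cvgB; apply: cvgMr; [exact: cvgy_expNpow|exact: cvgy_expR_half].
Qed.

(** For [a > 0] the primitive [expNpow_dom] has finite limits at both ends, so its derivative is an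
    integrable majorant. *)
Lemma integrable_gamma_kernel b a c d : 0 < a ->
  mu.-integrable `]0, +oo[ (EFin \o gamma_kernel b (a - 1) c d).
Proof.
move=> a0; set K := `|c| + `|d|.
have K0 : 0 <= K by rewrite addr_ge0.
have dom t : 0 < t -> `|gamma_kernel b (a - 1) c d t| <= expNpow_dom' a K t.
  move=> t0; apply: le_trans (expNpow_dom'_ge a K t a0 K0 t0).
  rewrite (le_trans (norm_gamma_kernel_le _ _ _ _ _))// ler_wpM2l// lerDl.
  exact: expNpow_ge0.
have ig : mu.-integrable `]0, +oo[ (EFin \o expNpow_dom' a K).
  apply: (ge0_integrable_itv0y (expNpow_dom' a K) (expNpow_dom a K)
    (expNpow_dom a K 0) 0).
  + by move=> t; exact: is_derive_expNpow_dom.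
  + by move=> t; exact: continuous_expNpow_dom'.
  + by move=> t /dom; apply: le_trans.
  + exact: cvg0_expNpow_dom.
  + exact: cvgy_expNpow_dom.
apply: le_integrable ig => //.
  apply/measurable_EFinP; apply: measurable_continuous_itv0y => t.
  exact: continuous_gamma_kernel.
move=> t; rewrite /= in_itv/= andbT lee_fin => /dom fgx.
by rewrite (le_trans fgx)// ler_norm.
Qed.

(** The difference of the two integrands is the derivative of [gamma_kernel b a c d], which tends to
    [0] at both ends. *)
Lemma Rintegral_gamma_kernel_parts b a c d : 0 < a ->
  \int[mu]_(t in `]0, +oo[) gamma_kernel b a c d t =
  \int[mu]_(t in `]0, +oo[)
    gamma_kernel b (a - 1) (a * c + b * d) (a * d - b * c) t.
Proof.
move=> a0; apply/eqP; rewrite eq_sym -subr_eq0; apply/eqP.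
rewrite -RintegralB//; last first.
(* The exponent [a] is read as [(a + 1) - 1] to fit the integrability lemma. *)
- by rewrite -{1}[a](addrK 1); apply: integrable_gamma_kernel; rewrite addr_gt0.
- exact: integrable_gamma_kernel.
set c' := a * c + _; set d' := a * d - _.
(* [K] collects the weights of both kernels, so one majorant controls their difference. *)
set K := `|c| + `|d| + (`|c'| + `|d'|).
rewrite -[RHS](subr0 0).
apply: (Rintegral_continuous_FTC_itv0y
  (fun t => gamma_kernel b (a - 1) c' d' t - gamma_kernel b a c d t)
  (gamma_kernel b a c d)
  (expNpow_dom' a K) (expNpow_dom a K) 0 0 (expNpow_dom a K 0) 0).
- by move=> t; exact: is_derive_gamma_kernel.
- by move=> t t0; apply: continuousB; exact: continuous_gamma_kernel.
- by apply: cvg_gamma_kernel; exact: cvg0_expNpow.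
- by apply: cvg_gamma_kernel; exact: cvgy_expNpow.
- by move=> t; exact: is_derive_expNpow_dom.
- by move=> t; exact: continuous_expNpow_dom'.
- exact: cvg0_expNpow_dom.
- exact: cvgy_expNpow_dom.
- move=> t t0; apply: le_trans (expNpow_dom'_ge _ _ _ a0 _ t0).
    rewrite (le_trans (ler_normB _ _))//.
    rewrite (le_trans (lerD (norm_gamma_kernel_le _ _ _ _ _)
      (norm_gamma_kernel_le _ _ _ _ _)))//.
    rewrite mulrDr addrC -/c' -/d'.
    by rewrite addrC lerD// ler_wpM2r ?expNpow_ge0// /K ?lerDl ?lerDr addr_ge0.
  by rewrite !addr_ge0.
Qed.

Lemma Rintegral_gamma_kernel b a c d : 0 < a ->
  \int[mu]_(t in `]0, +oo[) gamma_kernel b (a - 1) c d t =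
  c * \int[mu]_(t in `]0, +oo[) gamma_kernel b (a - 1) 1 0 t +
  d * \int[mu]_(t in `]0, +oo[) gamma_kernel b (a - 1) 0 1 t.
Proof.
move=> a0.
rewrite -!RintegralZl ?integrable_gamma_kernel//.
rewrite -RintegralD//; last 2 first.
- rewrite (_ : _ \o _ = EFin \o gamma_kernel b (a - 1) c 0)
    ?integrable_gamma_kernel//.
  by apply/funext => t /=; rewrite /gamma_kernel; congr EFin; ring.
- rewrite (_ : _ \o _ = EFin \o gamma_kernel b (a - 1) 0 d)
    ?integrable_gamma_kernel//.
  by apply/funext => t /=; rewrite /gamma_kernel; congr EFin; ring.
by apply: eq_Rintegral => t _; rewrite /gamma_kernel; ring.
Qed.

End GammaKernel.

(** * The functional equation of the quaternionic Gamma function *)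

Section GammaRecursion.
Context {R : realType}.
Implicit Types q : quaternion R.
Local Notation mu := (@lebesgue_measure R).

Let vnorm q : R := quat_norm (vecq q).

Lemma sqr_quat_norm_vecq q :
  vnorm q ^+ 2 = vec1 q ^+ 2 + vec2 q ^+ 2 + vec3 q ^+ 2.
Proof.
rewrite /vnorm /quat_norm sqr_sqrtr /quat_normsq /= ?expr0n/= ?add0r//.
by rewrite !addr_ge0 ?sqr_ge0.
Qed.

(** When the norm vanishes so does the vector part, so the convention [0^-1 = 0] is harmless. *)
Lemma quat_norm_vecqK q : vnorm q *: ((vnorm q)^-1 *: vecq q) = vecq q.
Proof.
have [n0|n0] := eqVneq (vnorm q) 0; last by rewrite scalerA mulfV ?scale1r.
rewrite n0 scale0r; apply/esym/eqP; rewrite -quat_normsq_eq0.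
have := sqr_quat_norm_vecq q.
by rewrite n0 /quat_normsq /= expr0n/= add0r => <-.
Qed.

(** The direction [v / |v|] does not depend on [t], so the four coordinate integrals reduce to one
    cosine and one sine integral. *)
Lemma qGammaE q : 0 < Sc q ->
  qGamma q =
  (\int[mu]_(t in `]0, +oo[) gamma_kernel (vnorm q) (Sc q - 1) 1 0 t)%:A +
  (\int[mu]_(t in `]0, +oo[) gamma_kernel (vnorm q) (Sc q - 1) 0 1 t) *:
    ((vnorm q)^-1 *: vecq q).
Proof.
move=> q0; set C := \int[_]_(_ in _) _; set S := \int[_]_(_ in _) _.
have E c d (f : R -> R) :
    (forall t, f t = gamma_kernel (vnorm q) (Sc q - 1) c d t) ->
    \int[mu]_(t in `]0, +oo[) f t = c * C + d * S.
  by move=> fE; rewrite -Rintegral_gamma_kernel//; apply: eq_Rintegral => t _.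
rewrite /qGamma /qintegral.
rewrite (E 1 0) => [|t]; last first.
  by rewrite /gamma_kernel /expNpow /qpow vecq_subr1 /= -/(vnorm q); ring.
rewrite (E 0 ((vnorm q)^-1 * vec1 q)) => [|t]; last first.
  by rewrite /gamma_kernel /expNpow /qpow vecq_subr1 /= -/(vnorm q); ring.
rewrite (E 0 ((vnorm q)^-1 * vec2 q)) => [|t]; last first.
  by rewrite /gamma_kernel /expNpow /qpow vecq_subr1 /= -/(vnorm q); ring.
rewrite (E 0 ((vnorm q)^-1 * vec3 q)) => [|t]; last first.
  by rewrite /gamma_kernel /expNpow /qpow vecq_subr1 /= -/(vnorm q); ring.
by congr Quat => /=; ring.
Qed.

(** By [qGammaE] the value lies in the real span of [1] and the vector part of [q]. *)
Lemma comm_qGamma q : 0 < Sc q -> GRing.comm q (qGamma q).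
Proof. by move=> /qGammaE ->; congr Quat => /=; ring. Qed.

(** With [a = Sc q - 1], [n = |v|] and [u = v / |v|], integration by parts gives
    [(a C - n S) + (n C + a S) u], which is [(C + S u) (a + n u)] because [u^2 = -1] when [n] is
    nonzero. *)
Lemma qGammaS q : 1 < Sc q -> qGamma q = qGamma (q - 1) * (q - 1).
Proof.
move=> q1; have s0 : 0 < Sc (q - 1) by rewrite /= subr_gt0.
rewrite (qGammaE q) ?(lt_trans ltr01)// (qGammaE (q - 1))//.
rewrite /vnorm !vecq_subr1 -/(vnorm q) /=.
rewrite !(Rintegral_gamma_kernel_parts _ (Sc q - 1))//.
rewrite !mulr0 !mulr1 !add0r !addr0 subr0.
rewrite (Rintegral_gamma_kernel _ _ (Sc q - 1) (- vnorm q))//.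
rewrite (Rintegral_gamma_kernel _ _ (vnorm q))//.
set C := \int[_]_(_ in _) _; set S := \int[_]_(_ in _) _.
have := quat_norm_vecqK q.
(* This replaces [u^2 = -1] in a form that also holds for [v = 0], where both sides are [0]. *)
have : (vnorm q)^-1 * (vec1 q ^+ 2 + vec2 q ^+ 2 + vec3 q ^+ 2) = vnorm q.
  rewrite -sqr_quat_norm_vecq; have [->|n0] := eqVneq (vnorm q) 0.
    by rewrite expr0n mulr0.
  by rewrite expr2 mulKf.
move: (vnorm q) => n nE [_ v1 v2 v3].
congr Quat => /=.
- by rewrite -{1}nE; ring.
(* Since [n] may be [0], the product [n * n^-1] is not cancelled; [v1] collapses it together with
   the coordinate. *)
- transitivity (C * (n * (n^-1 * vec1 q)) +
      (Sc q - 1) * S * (n^-1 * vec1 q)); first by ring.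
  by rewrite v1; ring.
- transitivity (C * (n * (n^-1 * vec2 q)) +
      (Sc q - 1) * S * (n^-1 * vec2 q)); first by ring.
  by rewrite v2; ring.
- transitivity (C * (n * (n^-1 * vec3 q)) +
      (Sc q - 1) * S * (n^-1 * vec3 q)); first by ring.
  by rewrite v3; ring.
Qed.

End GammaRecursion.

Theorem proposition4 (R : realType) (q : quaternion R) (hq : 1 < Sc q) (t : R) :
  (q - 1) * qBspline q t =
    t *: qBspline (q - 1) t + (q - t%:A) * qBspline (q - 1) (t - 1).
Proof.
apply: Bspline_recursion_of_Gamma => //; first exact: qGammaS.
have s0 : 0 < Sc (q - 1) by rewrite /= subr_gt0.
(* Gamma at [q - 1] commutes with [q - 1], hence with [q = (q - 1) + 1]. *)
rewrite -{1}(subrK 1 q); apply/commr_sym; apply: commrD; last exact: commr1.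
exact/commr_sym/comm_qGamma.
Qed.
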